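(* Assume $\lambda_1(-L)>0$, and let $\rho>0$ and $\kappa\in\mathbb R$ be such that for all $x\in\mathbb R$, $$\frac{V''(x)}{2}+\frac{V'(x)^2}{4}+\frac{\rho}{2}-\frac{\rho^2x^2}{4}\ \ge\ \kappa.$$ Then for every integer $n\ge1$, $$\lambda_n(-L)\ \ge\ \rho(n-1)+\kappa .$$
   Context: $V\in C^\infty(\mathbb R)$ with $\int e^{-V}dx<\infty$, $\mu$ the probability measure with density proportional to $e^{-V}$, $Lf=f''-V'f'$, self-adjoint in $L^2(\mu)$ (unique extension from $C_0^\infty(\mathbb R)$). $\lambda_0(-L)=0$ and for $n\ge1$, $\lambda_n(-L)=\sup_{g_0,\dots,g_{n-1}\in L^2(\mu)}\inf_{f\in D(-L)\setminus\{0\},\,f\perp_\mu g_i}\frac{\int f(-Lf)\,d\mu}{\int f^2d\mu}$; $\lambda_1(-L)$ is the spectral gap. *)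

(* Defs.v *)
From HB Require Import structures.
From mathcomp Require Import all_boot all_order all_algebra.
From mathcomp Require Import all_classical all_reals all_analysis.
Set Implicit Arguments. Unset Strict Implicit. Unset Printing Implicit Defensive.
Import Order.TTheory GRing.Theory Num.Theory.
Import numFieldNormedType.Exports.
Local Open Scope classical_set_scope.
Local Open Scope ring_scope.

Section Defs.
Variable R : realType.
Local Notation mu := (@lebesgue_measure R).

Definition smooth (f : R -> R) : Prop :=
  forall (n : nat) (x : R), derivable (derive1n n f) x 1.

Definition smooth_compact (f : R -> R) : Prop :=
  smooth f /\ exists M : R, forall x : R, M < `|x| -> f x = 0.

Definition Zc (V : R -> R) : R := Rintegral mu setT (fun x => expR (- V x)).

Definition dens (V : R -> R) (x : R) : R := expR (- V x) / Zc V.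

Definition L2 (V : R -> R) (f : R -> R) : Prop :=
  measurable_fun setT f /\
  (\int[mu]_x (((f x) ^+ 2 * dens V x)%:E) < +oo)%E.

Definition ip (V : R -> R) (f g : R -> R) : R :=
  Rintegral mu setT (fun x => f x * g x * dens V x).

Definition Lop (V : R -> R) (f : R -> R) : R -> R :=
  fun x => derive1n 2 f x - derive1 V x * derive1 f x.

(* graph of the closure in L^2(mu) of L defined on C_0^infty(R), i.e. of the
   (unique) self-adjoint extension:  f \in D(L) and Lf = g. *)
Definition Lclos (V : R -> R) (f g : R -> R) : Prop :=
  L2 V f /\ L2 V g /\
  exists phi : nat -> R -> R,
    (forall k, smooth_compact (phi k)) /\
    ((fun k => ip V (fun x => phi k x - f x) (fun x => phi k x - f x))
       @ \oo --> (0 : R)) /\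
    ((fun k => ip V (fun x => Lop V (phi k) x - g x)
                    (fun x => Lop V (phi k) x - g x))
       @ \oo --> (0 : R)).

(* lambda_n(-L) by the min-max formula, in the extended reals *)
Definition lambda (V : R -> R) (n : nat) : \bar R :=
  ereal_sup [set m : \bar R | exists gs : 'I_n -> R -> R,
     (forall i, L2 V (gs i)) /\
     m = ereal_inf [set q : \bar R | exists f g : R -> R,
            [/\ Lclos V f g, ip V f f != 0,
                (forall i, ip V f (gs i) = 0) &
                q = (ip V f (fun x => - g x) / ip V f f)%:E]]].
End Defs.

(* Main.v *)
(* Differentiation intertwines -L, off the constants, with an operator that is unitarily
   equivalent to the Schroedinger operator -d^2/dx^2 + V'^2/4 + V''/2. By hypothesis the
   latter dominates kappa plus -d^2/dx^2 + rho^2 x^2/4 - rho/2, which is the ground state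
   transform of the Ornstein-Uhlenbeck generator for W = rho x^2/2. Hence a lower bound c
   on the m-th eigenvalue for W yields the lower bound kappa + c on the (m+1)-st for V.
   Taking V = W, where kappa = rho is allowed, gives the bounds rho m for W by induction,
   and one more step with the given V concludes.

   Here "the m-th eigenvalue is at least C" means a Poincare inequality with constant
   C - eps for test functions, up to a penalty on m moments ([gap]). For phi of mean zero
   put U = int_(-oo)^x phi e^-V. The inequality for W applied to U e^((V+W)/2) bounds
   int phi^2 e^-V from below by int U^2 e^V, and it is turned into the inequality for
   phi' by (int phi^2 e^-V)^2 = (int phi' U)^2 <= int phi'^2 e^-V int U^2 e^V. Since
   phi e^-V = U', moments of U become moments of phi after truncating the weights to
   compact support and taking primitives. *)
Require Import Defs.
From HB Require Import structures.
From mathcomp Require Import all_boot all_order all_algebra.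
From mathcomp Require Import all_classical all_reals all_analysis.
From mathcomp Require Import measurable_realfun ring lra.
Import Order.TTheory GRing.Theory Num.Theory.
Import numFieldNormedType.Exports.
Local Open Scope classical_set_scope.
Local Open Scope ring_scope.

Set Implicit Arguments. Unset Strict Implicit. Unset Printing Implicit Defensive.

(** * Integrals over the line, and test functions with compact support *)

Section Integrals.
Context {R : realType}.
Local Notation mu := (@lebesgue_measure R).
Implicit Types f g : R -> R.

Definition intgR f := mu.-integrable setT (EFin \o f).
Definition cont_compact f := continuous f /\ exists M : R, forall x, M < `|x| -> f x = 0.
(** The derivative is an argument, so that it keeps the explicit form produced by the product and
    chain rules. *)
Definition C1_compact f f' :=
  [/\ forall x : R, is_derive x 1 f (f' x), continuous f' &
      exists M : R, forall x, M < `|x| -> f x = 0].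

Local Notation I f := (Rintegral mu setT f).

Lemma intgRD f g : intgR f -> intgR g -> intgR (fun x => f x + g x).
Proof.
move=> hf hg; rewrite /intgR.
rewrite (_ : EFin \o _ = (EFin \o f) \+ (EFin \o g))%E.
  exact: integrableD.
by apply/funext => x.
Qed.

Lemma intgRZ (c : R) f : intgR f -> intgR (fun x => c * f x).
Proof.
move=> hf; rewrite /intgR.
rewrite (_ : EFin \o _ = (fun x => c%:E * (EFin \o f) x))%E.
  exact: integrableZl.
by apply/funext => x.
Qed.

Lemma intgR_le f g : measurable_fun setT f -> (forall x, `|f x| <= g x) ->
  intgR g -> intgR f.
Proof.
move=> mf fg hg; apply: (le_integrable _ _ _ hg) => //.
  exact/measurable_EFinP.
move=> x _; rewrite /= lee_fin (le_trans (fg x))//; exact: ler_norm.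
Qed.

Lemma intgR_measurable f : intgR f -> measurable_fun setT f.
Proof. by move/integrableP => [/measurable_EFinP]. Qed.

Lemma IntD f g : intgR f -> intgR g -> I (fun x => f x + g x) = I f + I g.
Proof. by move=> hf hg; exact: RintegralD. Qed.

Lemma IntZ (c : R) f : intgR f -> I (fun x => c * f x) = c * I f.
Proof. by move=> hf; exact: RintegralZl. Qed.

Lemma Int_ge0 f : (forall x, 0 <= f x) -> 0 <= I f.
Proof. by move=> f0; apply: Rintegral_ge0. Qed.

Lemma Int_le f g : intgR f -> intgR g -> (forall x, f x <= g x) -> I f <= I g.
Proof. by move=> hf hg fg; apply: le_Rintegral. Qed.

Lemma Int_ext f g : (forall x, f x = g x) -> I f = I g.
Proof. by move=> fg; apply: eq_Rintegral => x _; exact: fg. Qed.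

Lemma compact_support_itv f : (exists M : R, forall x, M < `|x| -> f x = 0) ->
  exists2 M : R, 0 < M & (forall x, x \notin `[- M, M] -> f x = 0).
Proof.
move=> [M hM]; exists (Num.max M 1); first by rewrite lt_max ltr01 orbT.
move=> x; rewrite in_itv/= -ler_norml -ltNge gt_max => /andP[] /hM //.
Qed.

Lemma restrict_itvE f M : (forall x, x \notin `[- M, M] -> f x = 0) ->
  f \_ `[- M, M] = f.
Proof.
move=> h; apply/funext => x; rewrite patchE; case: ifPn => // hx.
by rewrite h//; apply: contra hx => hx; rewrite inE.
Qed.

Lemma cont_compact_intgR f : cont_compact f -> intgR f.
Proof.
move=> [cf /compact_support_itv[M M0 hM]]; rewrite /intgR.
have mM : measurable (`[- M, M] : set R) by exact: measurable_itv.
have := @continuous_compact_integrable R f `[- M, M] (@segment_compact _ _ _)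
  (continuous_subspaceT cf).
move=> h; have := (@integrable_mkcond _ _ R mu _ (EFin \o f) mM).1 h.
by rewrite restrict_EFin restrict_itvE.
Qed.

(** The condition [M < |x|] is open, so [f] coincides with the zero function near such an [x] and
    its derivative vanishes there. *)
Lemma C1_compact_deriv0 f f' : C1_compact f f' -> cont_compact f'.
Proof.
move=> [df cf [M hM]]; split => //; exists M => x hx.
have := df x; move=> /@derive_val <-.
have /near_eq_derive -> : \forall y \near x, f y = (fun _ => 0) y.
  have h : \forall y \near x, M < `|y|.
    have : \forall y \near `|x|, M < y by apply: lt_nbhsr.
    by apply: (@norm_continuous _ R x).
  near=> y; apply: hM.
  by near: y; exact: h.
by rewrite derive_cst.
Unshelve. all: by end_near. Qed.

Lemma Int_deriv f f' : C1_compact f f' -> I f' = 0.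
Proof.
move=> hf; have [M' M'0 f'0] := compact_support_itv (C1_compact_deriv0 hf).2.
have [df cf /compact_support_itv[M M0 hM]] := hf.
(* [N] exceeds both radii strictly: [f'] vanishes outside [[-N, N]], and [f] vanishes at the two
   endpoints. *)
pose N := M' + M.
have NM : M < N by rewrite /N ltrDr.
have f'N x : x \notin `[- N, N] -> f' x = 0.
  rewrite in_itv/= -ler_norml -ltNge => hx; apply: f'0.
  by rewrite in_itv/= -ler_norml -ltNge (lt_trans _ hx)// ltrDl.
rewrite -(restrict_itvE f'N) -Rintegral_mkcond /Rintegral.
rewrite (@continuous_FTC2 R f' f).
- rewrite /= !hM ?subrr// in_itv/= -ler_norml ?normrN -ltNge gtr0_norm//;
  exact: lt_trans NM.
- by rewrite gtrN// (lt_trans M0).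
- exact: continuous_subspaceT.
- have cF : continuous f by move=> x; apply/differentiable_continuous/derivable1_diffP.
  split; first by move=> x _.
  + exact/cvg_at_right_filter/cF.
  + exact/cvg_at_left_filter/cF.
- by move=> x _; rewrite derive1E derive_val.
Qed.

End Integrals.

(** * Rules for continuity and derivatives, integration by parts, primitives, Cauchy-Schwarz *)

Section Calculus.
Context {R : realType}.
Local Notation mu := (@lebesgue_measure R).
Local Notation I f := (Rintegral mu setT f).
Implicit Types (f g : R -> R) (x : R).

Lemma contD f g : continuous f -> continuous g -> continuous (fun x => f x + g x).
Proof. by move=> cf cg x; apply: cvgD; [exact: cf|exact: cg]. Qed.

Lemma contM f g : continuous f -> continuous g -> continuous (fun x => f x * g x).
Proof. by move=> cf cg x; apply: cvgM; [exact: cf|exact: cg]. Qed.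

Lemma contN f : continuous f -> continuous (fun x => - f x).
Proof. by move=> cf x; apply: cvgN; exact: cf. Qed.

Lemma contX f n : continuous f -> continuous (fun x => f x ^+ n).
Proof.
move=> cf; elim: n => [|n ih]; first by move=> x; exact: cvg_cst.
rewrite (_ : (fun x => _) = (fun x => f x * f x ^+ n)); first exact: contM.
by apply/funext => x; rewrite exprS.
Qed.

Lemma cont_expR f : continuous f -> continuous (fun x => expR (f x)).
Proof. by move=> cf x; apply: continuous_comp; [exact: cf|exact: continuous_expR]. Qed.

Lemma cont_const (c : R) : continuous (fun _ : R => c).
Proof. by move=> x; exact: cvg_cst. Qed.

Lemma cont_ident : continuous (fun x : R => x).
Proof. by move=> x; exact: cvg_id. Qed.

Lemma is_derive_cont f f' : (forall x, is_derive x 1 f (f' x)) -> continuous f.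
Proof.
move=> df x; apply/differentiable_continuous/derivable1_diffP.
by have [] := df x.
Qed.

Lemma derD f g (f' g' : R) x : is_derive x 1 f f' -> is_derive x 1 g g' ->
  is_derive x 1 (fun x => f x + g x) (f' + g').
Proof. by move=> df dg; exact: is_deriveD. Qed.

Lemma derM f g (f' g' : R) x : is_derive x 1 f f' -> is_derive x 1 g g' ->
  is_derive x 1 (fun x => f x * g x) (f' * g x + f x * g').
Proof.
move=> df dg; rewrite addrC [f' * _]mulrC.
exact: (@is_deriveM _ _ f g x 1 f' g' df dg).
Qed.

Lemma derZ (c : R) f (f' : R) x : is_derive x 1 f f' ->
  is_derive x 1 (fun x => c * f x) (c * f').
Proof.
by move=> df; exact: (@is_deriveZ _ _ _ f c x 1 f' df).
Qed.

Lemma der_expR f (f' : R) x : is_derive x 1 f f' ->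
  is_derive x 1 (fun x => expR (f x)) (expR (f x) * f').
Proof.
by move=> df; exact: (@is_derive1_comp _ expR f x _ _ (is_derive_expR _) df).
Qed.

Lemma der_cst (c : R) x : is_derive x 1 (fun _ : R => c) 0.
Proof. exact: is_derive_cst. Qed.

Lemma der_id x : is_derive x 1 (fun x : R => x) 1.
Proof. exact: is_derive_id. Qed.

Lemma cc_cont f : cont_compact f -> continuous f. Proof. by case. Qed.

Lemma ccMl f g : cont_compact f -> continuous g -> cont_compact (fun x => f x * g x).
Proof.
move=> [cf [M hM]] cg; split; first exact: contM.
by exists M => x /hM ->; rewrite mul0r.
Qed.

Lemma ccMr f g : continuous f -> cont_compact g -> cont_compact (fun x => f x * g x).
Proof.
move=> cf [cg [M hM]]; split; first exact: contM.
by exists M => x /hM ->; rewrite mulr0.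
Qed.

Lemma ccD f g : cont_compact f -> cont_compact g -> cont_compact (fun x => f x + g x).
Proof.
move=> [cf [M hM]] [cg [N hN]]; split; first exact: contD.
by exists (Num.max M N) => x; rewrite gt_max => /andP[/hM -> /hN ->]; rewrite addr0.
Qed.

Lemma ccX f n : cont_compact f -> cont_compact (fun x => f x ^+ n.+1).
Proof.
move=> [cf [M hM]]; split; first exact: contX.
by exists M => x /hM ->; rewrite expr0n.
Qed.

Lemma C1cc f f' : C1_compact f f' -> cont_compact f.
Proof. by move=> [df cf' hM]; split => //; exact: is_derive_cont df. Qed.

Lemma C1M f f' g g' : C1_compact f f' -> (forall x, is_derive x 1 g (g' x)) ->
  continuous g' -> C1_compact (fun x => f x * g x) (fun x => f' x * g x + f x * g' x).
Proof.
move=> Cf dg cg'; have [df cf' [M hM]] := Cf; split.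
- by move=> x; apply: derM.
- apply: contD; apply: contM => //; first exact: is_derive_cont dg.
  exact: is_derive_cont df.
- by exists M => x /hM ->; rewrite mul0r.
Qed.

Lemma C1D f f' g g' : C1_compact f f' -> C1_compact g g' ->
  C1_compact (fun x => f x + g x) (fun x => f' x + g' x).
Proof.
move=> [df cf' [M hM]] [dg cg' [N hN]]; split.
- by move=> x; apply: derD.
- exact: contD.
- by exists (Num.max M N) => x; rewrite gt_max => /andP[/hM -> /hN ->]; rewrite addr0.
Qed.

Lemma C1Z (c : R) f f' : C1_compact f f' ->
  C1_compact (fun x => c * f x) (fun x => c * f' x).
Proof.
move=> [df cf' [M hM]]; split.
- by move=> x; apply: derZ.
- by apply: contM => //; exact: cont_const.
- by exists M => x /hM ->; rewrite mulr0.
Qed.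

Lemma Int_by_parts f f' g g' : C1_compact f f' ->
  (forall x, is_derive x 1 g (g' x)) -> continuous g' ->
  I (fun x => f' x * g x) = - I (fun x => f x * g' x).
Proof.
move=> Cf dg cg'; have := Int_deriv (C1M Cf dg cg').
have cg := is_derive_cont dg.
rewrite IntD; last 2 first.
  by apply/cont_compact_intgR/ccMl => //; exact: C1_compact_deriv0 Cf.
  by apply/cont_compact_intgR/ccMl => //; exact: C1cc Cf.
by move/eqP; rewrite addr_eq0 => /eqP.
Qed.

(** Starting at [-oo] makes the primitive vanish to the left of the support of [g], and also to the
    right of it when the total integral is zero. *)
Definition prim g (x : R) : R := Rintegral mu `]-oo, x] g.

Lemma prim_derive g : cont_compact g -> forall x, is_derive x 1 (prim g) (g x).
Proof.
move=> cg x; have ig := cont_compact_intgR cg.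
(* The endpoint [x + 1] only serves to make [x] an interior point. *)
have [||||d e] := @continuous_FTC1 R g -oo%O x (x + 1).
- by rewrite ltrDl.
- by apply: integrableS ig => //; exact: measurable_itv.
- by rewrite ltNyr.
- exact: (cc_cont cg).
- by apply: DeriveDef => //; rewrite -derive1E.
Qed.

(** This bound makes primitives admissible as bounded moment weights. *)
Lemma prim_le g x : cont_compact g -> `|prim g x| <= I (fun y => `|g y|).
Proof.
move=> cg; rewrite /prim Rintegral_mkcond.
have ig := cont_compact_intgR cg.
have mg := intgR_measurable ig.
have ign : intgR (fun y => `|g y|).
  apply: (@intgR_le _ _ _ _ _ (cont_compact_intgR (_ : cont_compact (fun y => `|g y|)))).
  - exact: measurableT_comp.
  - by move=> y; rewrite normr_id.
  - case: cg => cg [M hM]; split; last by exists M => y /hM ->; rewrite normr0.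
    by move=> y; apply: cvg_norm; exact: cg.
have ir : intgR (g \_ `]-oo, x]).
  apply: (intgR_le _ _ ign).
  - apply/(measurable_restrictT _ _).1; first exact: measurable_itv.
    exact: measurable_funTS.
  - by move=> y; rewrite patchE; case: ifP => // _; rewrite normr0.
apply: (le_trans (le_normr_Rintegral _ ir)) => //.
apply: Int_le => //.
- apply: (intgR_le _ _ ign); first by apply: measurableT_comp => //; exact: intgR_measurable ir.
  by move=> y; rewrite normr_id patchE; case: ifP => // _; rewrite normr0.
- by move=> y; rewrite patchE; case: ifP => // _; rewrite normr0.
Qed.

Lemma C1_compact_prim g : cont_compact g -> I g = 0 -> C1_compact (prim g) g.
Proof.
move=> cg g0; split; [exact: prim_derive|exact: cc_cont|].
have [M M0 hM] := compact_support_itv cg.2.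
exists M => x; rewrite ltr_normr /prim Rintegral_mkcond => /orP[h|h].
  rewrite -[RHS]g0; congr (Rintegral _ _ _); apply/funext => y; rewrite patchE.
  case: ifPn => //; rewrite notin_setE /= in_itv/= => /negP; rewrite -ltNge => hy.
  by rewrite hM// in_itv/= negb_and -!ltNge (lt_trans h hy) orbT.
rewrite (_ : g \_ _ = (fun=> 0)); last first.
  apply/funext => y; rewrite patchE.
  case: ifPn => //; rewrite inE /= in_itv/= => hy.
  by rewrite hM// in_itv/= negb_and -!ltNge (le_lt_trans hy)// ltrNr.
by rewrite Rintegral_cst// mul0r.
Qed.

Lemma Int_Cauchy_Schwarz f g : intgR (fun x => f x ^+ 2) ->
  intgR (fun x => g x ^+ 2) -> intgR (fun x => f x * g x) ->
  I (fun x => f x * g x) ^+ 2 <= I (fun x => f x ^+ 2) * I (fun x => g x ^+ 2).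
Proof.
move=> hf hg hfg.
set a := I (fun x => f x ^+ 2); set c := I (fun x => g x ^+ 2); set b := I _.
have a0 : 0 <= a by apply: Int_ge0 => x; exact: sqr_ge0.
have c0 : 0 <= c by apply: Int_ge0 => x; exact: sqr_ge0.
have H t : 0 <= a + 2 * t * b + t ^+ 2 * c.
  have -> : a + 2 * t * b + t ^+ 2 * c = I (fun x => (f x + t * g x) ^+ 2).
    rewrite /a /b /c -IntZ// -IntZ// -IntD; [|by []|exact: intgRZ].
    rewrite -IntD; [|by apply: intgRD => //; exact: intgRZ|exact: intgRZ].
    by apply: Int_ext => x; ring.
  by apply: Int_ge0 => x; exact: sqr_ge0.
(* If [c = 0], the expression in [H] is affine in [t], and when [b] is nonzero the chosen [t] gives
   it the value [-1]. Otherwise [t = - b / c] is the minimiser of the quadratic. *)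
have [c_0|cn0] := eqVneq c 0.
  have := H (- (a + 1) / (2 * b)); have [->|bn0] := eqVneq b 0.
    by move=> _; rewrite c_0 expr0n mulr0.
  by rewrite c_0 mulr0 addr0 (_ : a + _ = -1); [rewrite oppr_ge0 ler10|field].
have cp : 0 < c by rewrite lt_neqAle eq_sym cn0.
have := H (- b / c); rewrite (_ : _ + _ = (a * c - b ^+ 2) / c); last by field.
by rewrite ler_pdivlMr// mul0r subr_ge0.
Qed.

End Calculus.

(* Syntactic matching: bare [apply:] would unfold [^+], [expR] and local definitions. *)
Ltac cont_head g :=
  lazymatch g with
  | (fun x => @GRing.exp _ _ _) => apply: contX
  | @GRing.mul _ _ => exact: mulrl_continuous
  | (fun x => @GRing.mul _ _ _) => apply: contM
  | (fun x => @GRing.opp _ _) => apply: contN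
  | (fun x => expR _) => apply: cont_expR
  | (fun x => x) => apply: cont_ident
  | (fun _ => ?c) => apply: cont_const
  | _ => apply: contD
  end.

Ltac cont := repeat first [assumption | lazymatch goal with
  | |- forall x, @continuous_at _ _ x ?g => cont_head g end].

(** * Truncation to compact support in [L^2], and integrability of Gaussians *)

Section Truncation.
Context {R : realType}.
Local Notation mu := (@lebesgue_measure R).
Local Notation I f := (Rintegral mu setT f).
Implicit Types (f g : R -> R) (x : R).

Definition cutoff (N : R) x : R := Num.max 0 (Num.min 1 (N + 1 - `|x|)).

Lemma cutoff_ge0 N x : 0 <= cutoff N x.
Proof. by rewrite le_max lexx. Qed.

Lemma cutoff_le1 N x : cutoff N x <= 1.
Proof. by rewrite ge_max ler01 ge_min lexx. Qed.

Lemma cutoff1 N x : `|x| <= N -> cutoff N x = 1.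
Proof. by move=> xN; rewrite /cutoff min_l ?max_r//; lra. Qed.

Lemma cutoff0 N x : N + 1 < `|x| -> cutoff N x = 0.
Proof. by move=> xN; rewrite /cutoff max_l// ge_min; apply/orP; right; lra. Qed.

Lemma cont_cutoff N : continuous (cutoff N).
Proof.
move=> x; apply: (@continuous_max R R (fun=> 0) (fun x => Num.min 1 (N + 1 - `|x|))).
  exact: cvg_cst.
apply: (@continuous_min R R (fun=> 1) (fun x => N + 1 - `|x|)); first exact: cvg_cst.
apply: cvgB; first exact: cvg_cst.
exact: norm_continuous.
Qed.

(** The remainder is [r] times one minus a cutoff. Its square is dominated by [r ^+ 2] and is zero
    at [x] as soon as [n] exceeds [|x|], so dominated convergence applies. *)
Lemma L2_truncation (r : R -> R) (delta : R) : continuous r ->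
  intgR (fun x => r x ^+ 2) -> 0 < delta ->
  exists h, [/\ cont_compact h, intgR (fun x => (r x - h x) ^+ 2) &
    I (fun x => (r x - h x) ^+ 2) <= delta].
Proof.
move=> cr ir d0.
pose h (n : nat) x := r x * cutoff n%:R x.
have ch n : cont_compact (h n).
  by apply: ccMr => //; split; [exact: cont_cutoff|exists (n%:R + 1); exact: cutoff0].
have le_r n x : (r x - h n x) ^+ 2 <= r x ^+ 2.
  rewrite /h (_ : r x - _ = r x * (1 - cutoff n%:R x)); last by ring.
  rewrite exprMn ler_piMr ?sqr_ge0// expr_le1//.
  - by rewrite lerBlDr lerDl cutoff_ge0.
  - by rewrite subr_ge0 cutoff_le1.
have mrh n : measurable_fun setT (fun x => (r x - h n x) ^+ 2).
  apply: continuous_measurable_fun; apply: contX; apply: contD => //.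
  by apply: contN; exact: cc_cont.
have irh n : intgR (fun x => (r x - h n x) ^+ 2).
  apply: (intgR_le (mrh n) _ ir) => x.
  by rewrite ger0_norm ?sqr_ge0.
have : (\int[mu]_x ((r x - h n x) ^+ 2)%:E)%E @[n --> \oo] -->
    (\int[mu]_x (fun=> 0%E) x)%E.
  apply: (@dominated_cvg _ _ R mu setT measurableT
    (fun n x => ((r x - h n x) ^+ 2)%:E) (fun=> 0%E) (fun x => (r x ^+ 2)%:E)).
  - by move=> n; exact: ((measurable_EFinP _ _).2 (mrh n)).
  - move=> x _; apply: cvg_near_cst.
    near=> n; rewrite /h cutoff1 ?mulr1 ?subrr ?expr0n//.
    by near: n; exact: nbhs_infty_ger.
  - by [].
  - exact: ir.
  - by move=> n x _; rewrite lee_fin ger0_norm ?sqr_ge0.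
rewrite integral0 => /fine_cvgP[_ /cvgr_lt /(_ delta d0)].
move=> [n _ hn]; exists (h n); split => //.
by apply: ltW; apply: hn => /=.
Unshelve. all: by end_near. Qed.

(** Up to its peak value, this is the normal density with standard deviation [rho^(-1/2)]. *)
Lemma intgR_gauss (rho : R) : 0 < rho -> intgR (fun x => expR (- (rho / 2 * x ^+ 2))).
Proof.
move=> r0; have s0 : (Num.sqrt rho)^-1 != 0 :> R by rewrite invr_eq0 sqrtr_eq0 -ltNge.
have h := intgRZ (normal_peak (Num.sqrt rho)^-1)^-1
  (@integrable_normal_pdf R 0 (Num.sqrt rho)^-1).
rewrite (_ : (fun x => expR _) = (fun x => (normal_peak (Num.sqrt rho)^-1)^-1 *
   normal_pdf 0 (Num.sqrt rho)^-1 x))//.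
apply/funext => x; rewrite normal_pdfE//= mulrA mulVf ?mul1r ?gt_eqF ?normal_peak_gt0//.
rewrite /normal_fun subr0 exprVn sqr_sqrtr ?(ltW r0)//; congr expR.
by rewrite mulr2n; field; rewrite gt_eqF.
Qed.

End Truncation.

(** * Poincare inequalities modulo finitely many moments *)

Section Gap.
Context {R : realType}.
Local Notation mu := (@lebesgue_measure R).
Local Notation I f := (Rintegral mu setT f).
Implicit Types (V f g phi : R -> R) (x : R).

Definition wint V f : R := I (fun x => f x * expR (- V x)).

(** Bounded weights are square integrable against any finite measure [e^-V dx], so they can serve as
    the functions [gs] in [lambda]. *)
Definition bounded_cont f := continuous f /\ exists M : R, forall x, `|f x| <= M.

(* Modulo finitely many moments, the Poincare constant of [exp (- V)] is almost [C]. *)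
Definition gap V (C : R) (m : nat) := forall eps : R, 0 < eps ->
  exists (K : R) (p : 'I_m -> R -> R), [/\ 0 <= K, forall i, bounded_cont (p i) &
    forall phi phi', C1_compact phi phi' ->
      (C - eps) * wint V (fun x => phi x ^+ 2)
      - K * \sum_(i < m) wint V (fun x => phi x * p i x) ^+ 2
      <= wint V (fun x => phi' x ^+ 2)].

Lemma wint_ge0 V f : (forall x, 0 <= f x) -> 0 <= wint V f.
Proof. by move=> f0; apply: Int_ge0 => x; rewrite mulr_ge0// expR_ge0. Qed.

Lemma cc_weight V f : continuous V -> cont_compact f ->
  cont_compact (fun x => f x * expR (- V x)).
Proof. by move=> cV cf; apply: ccMl => //; cont. Qed.

Lemma wint_int V f : continuous V -> cont_compact f ->
  intgR (fun x => f x * expR (- V x)).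
Proof. by move=> cV cf; apply/cont_compact_intgR/cc_weight. Qed.

Lemma wintD V f g : continuous V -> cont_compact f -> cont_compact g ->
  wint V (fun x => f x + g x) = wint V f + wint V g.
Proof.
move=> cV cf cg; rewrite /wint -IntD; [|exact: wint_int|exact: wint_int].
by apply: Int_ext => x; rewrite mulrDl.
Qed.

Lemma wintZ V (c : R) f : continuous V -> cont_compact f ->
  wint V (fun x => c * f x) = c * wint V f.
Proof.
move=> cV cf; rewrite /wint -IntZ; last exact: wint_int.
by apply: Int_ext => x; rewrite mulrA.
Qed.

Lemma wint_le V f g : continuous V -> cont_compact f -> cont_compact g ->
  (forall x, f x <= g x) -> wint V f <= wint V g.
Proof.
move=> cV cf cg fg; apply: Int_le; [exact: wint_int|exact: wint_int|].
by move=> x; rewrite ler_wpM2r// expR_ge0.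
Qed.

Lemma wint_ext V f g : (forall x, f x = g x) -> wint V f = wint V g.
Proof. by move=> fg; apply: Int_ext => x; rewrite fg. Qed.

Lemma gap0 V : gap V 0 0.
Proof.
move=> eps e0; exists 0, (fun _ _ => 0); split => //.
  by move=> i; split; [exact: cont_const|exists 0 => x; rewrite normr0].
move=> phi phi' _; rewrite mul0r subr0 sub0r mulNr.
rewrite (@le_trans _ _ 0) ?oppr_le0 ?mulr_ge0 ?(ltW e0)//; apply: wint_ge0 => x;
  exact: sqr_ge0.
Qed.

Lemma wint_sqr_le (a b c : R) V f g h : continuous V ->
  cont_compact f -> cont_compact g -> cont_compact h ->
  (forall x, f x ^+ 2 <= a * g x ^+ 2 + b * h x ^+ 2) ->
  wint V (fun x => f x ^+ 2) <=
  a * wint V (fun x => g x ^+ 2) + b * wint V (fun x => h x ^+ 2).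
Proof.
move=> cV cf cg ch H.
have c2 (k : R) u : cont_compact u -> cont_compact (fun x => k * u x ^+ 2).
  by move=> cu; apply: ccMr; [exact: cont_const|exact: ccX].
rewrite -(wintZ a cV (ccX 1 cg)) -(wintZ b cV (ccX 1 ch)).
rewrite -(wintD cV (c2 _ _ cg) (c2 _ _ ch)).
apply: wint_le => //; first exact: ccX.
by apply: ccD; exact: c2.
Qed.

(* [A], [B], [D] and [S] stand for the integrals of
   [phi'^2], [phi^2], [U^2] and the squared moments, respectively. *)
Lemma dual_ineq (A B D S C : R) : 0 <= A -> 0 <= B -> 0 <= D -> 0 <= S ->
  B ^+ 2 <= A * D -> C * D <= B + S -> C * B - Num.max 0 C * S <= A.
Proof.
move=> A0 B0 D0 S0 BAD CD.
have [C0|C0] := leP C 0.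
  rewrite mul0r subr0; apply: le_trans A0; exact: mulr_le0_ge0.
rewrite -mulrBr.
have [BS|BS] := eqVneq (B + S) 0.
  have B_0 : B = 0 by lra.
  have S_0 : S = 0 by lra.
  by rewrite B_0 S_0 subr0 mulr0.
have BSp : 0 < B + S by rewrite lt_neqAle eq_sym BS addr_ge0.
(* The chain is [C (B - S) (B + S) <= C B^2 <= A (C D) <= A (B + S)]. *)
rewrite -(ler_pM2r BSp).
apply: (@le_trans _ _ (C * B ^+ 2)).
  rewrite -mulrA ler_pM2l// (_ : (B - S) * (B + S) = B ^+ 2 - S ^+ 2); last by ring.
  by rewrite gerBl sqr_ge0.
apply: (@le_trans _ _ (C * (A * D))); first by rewrite ler_pM2l.
by rewrite mulrCA ler_wpM2l.
Qed.

(** * Transfer of the inequality from [W] to mean-zero test functions for [V] *)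

Section Orthogonal.
Variables (V V1 V2 : R -> R) (rho kappa : R).
Hypothesis dV : forall x, is_derive x 1 V (V1 x).
Hypothesis dV1 : forall x, is_derive x 1 V1 (V2 x).
Hypothesis cV2 : continuous V2.
Hypothesis rho_gt0 : 0 < rho.
Hypothesis convV : forall x,
  kappa <= V2 x / 2 + V1 x ^+ 2 / 4 + rho / 2 - rho ^+ 2 * x ^+ 2 / 4.

Let W x := rho / 2 * x ^+ 2.
Let cV : continuous V := is_derive_cont dV.
Let cV1 : continuous V1 := is_derive_cont dV1.
Let cW : continuous W. Proof. by rewrite /W; cont. Qed.

Let dW x : is_derive x 1 W (rho * x).
Proof.
have -> : W = (fun x => rho / 2 * (x * x)) by apply/funext => y; rewrite /W expr2.
apply: (is_derive_eq (derZ (rho / 2) (derM (der_id x) (der_id x)))).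
by field.
Qed.

(** The factor is chosen so that [psi U x ^+ 2 * expR (- W x)] equals [U x ^+ 2 * expR (V x)]: it
    maps [L^2(e^V dx)] isometrically to [L^2(e^-W dx)]. *)
Let psi (U : R -> R) x := U x * expR ((V x + W x) / 2).
Let psi' (U U' : R -> R) x := U' x * expR ((V x + W x) / 2) +
  U x * (expR ((V x + W x) / 2) * (2^-1 * (V1 x + rho * x))).

Let C1_psi U U' : C1_compact U U' -> C1_compact (psi U) (psi' U U').
Proof.
move=> CU; apply: C1M => //; last by cont.
move=> x; apply: der_expR.
have -> : (fun x => (V x + W x) / 2) = (fun x => 2^-1 * (V x + W x)).
  by apply/funext => y; rewrite mulrC.
exact: derZ (derD (dV x) (dW x)).
Qed.

Let expR_half x : expR ((V x + W x) / 2) ^+ 2 * expR (- W x) = expR (V x).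
Proof. by rewrite expr2 -!expRD; congr expR; field. Qed.

(* Pointwise, the right side plus half the derivative of [U^2 (V' + rho x) e^V] exceeds
   the left side by [U^2 e^V] times the slack in [convV]. *)
Lemma twisted_ineq U U' : C1_compact U U' ->
  wint W (fun x => psi' U U' x ^+ 2) + kappa * I (fun x => U x ^+ 2 * expR (V x)) <=
  I (fun x => U' x ^+ 2 * expR (V x)).
Proof.
move=> CU; have [dU cU' _] := CU; have ccU := C1cc CU; have ccU' := C1_compact_deriv0 CU.
have ceV : continuous (fun x => expR (V x)) by cont.
have i1 : intgR (fun x => U x ^+ 2 * expR (V x)).
  by apply/cont_compact_intgR/ccMl => //; exact: ccX.
have i2 : intgR (fun x => U' x ^+ 2 * expR (V x)).
  by apply/cont_compact_intgR/ccMl => //; exact: ccX.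
have i3 : intgR (fun x => psi' U U' x ^+ 2 * expR (- W x)).
  by apply: wint_int => //; apply: ccX; exact: C1_compact_deriv0 (C1_psi CU).
pose q x := (V1 x + rho * x) * expR (V x).
pose q' x := (V2 x + rho) * expR (V x) + (V1 x + rho * x) * (expR (V x) * V1 x).
have dq x : is_derive x 1 q (q' x).
  have := derM (derD (dV1 x) (derZ rho (der_id x))) (der_expR (dV x)).
  by rewrite mulr1.
have CQ := C1M (C1M CU dU cU') dq ltac:(rewrite /q'; cont).
have := Int_deriv CQ; set Q' := (X in Rintegral _ _ X) => Q0.
have iQ : intgR Q' by apply/cont_compact_intgR; exact: C1_compact_deriv0 CQ.
rewrite -[leRHS]addr0 -(mulr0 (2^-1)) -[in leRHS]Q0 -!IntZ// -!IntD//; try exact: intgRZ.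
apply: Int_le.
- by apply: intgRD => //; exact: intgRZ.
- by apply: intgRD => //; exact: intgRZ.
move=> x; rewrite /psi' /Q' /q /q'.
have := expR_half x; set e := expR (_ / 2) => he.
rewrite [X in X + _](_ : _ =
   (U' x + U x * (2^-1 * (V1 x + rho * x))) ^+ 2 * (e ^+ 2 * expR (- W x))); last by ring.
rewrite he -subr_ge0.
rewrite (_ : _ - _ = (U x ^+ 2 * expR (V x)) *
  (V2 x / 2 + V1 x ^+ 2 / 4 + rho / 2 - rho ^+ 2 * x ^+ 2 / 4 - kappa)); last by field.
apply: mulr_ge0; last by rewrite subr_ge0; exact: convV.
by rewrite mulr_ge0 ?sqr_ge0 ?expR_ge0.
Qed.

(** Of the allowed loss [eps], half is spent in [gap W] and half absorbs the error of truncating the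
    weights. The mean-zero condition gives the primitive [U] compact support. *)
Lemma gap_orthogonal (c : R) (m : nat) : gap W c m ->
  forall eps : R, 0 < eps ->
  exists (K : R) (p : 'I_m -> R -> R), [/\ 0 <= K, forall i, bounded_cont (p i) &
    forall phi phi', C1_compact phi phi' -> wint V phi = 0 ->
      (kappa + c - eps) * wint V (fun x => phi x ^+ 2)
      - K * \sum_(i < m) wint V (fun x => phi x * p i x) ^+ 2
      <= wint V (fun x => phi' x ^+ 2)].
Proof.
move=> gapW eps e0; have e20 : 0 < eps / 2 by rewrite divr_gt0.
have [K [p [K0 bp gapK]]] := gapW _ e20.
(* This makes the total truncation error [K * m * (2 * delta)] at most [eps / 2]; the [+ 1] keeps
   the denominator positive when [K] or [m] is zero. *)
pose delta := eps / (4 * (K * m%:R + 1)).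
have Km0 : 0 < K * m%:R + 1 by rewrite ltr_wpDl// mulr_ge0.
have d0 : 0 < delta by rewrite divr_gt0// mulr_gt0.
(* The moment of [psi U] against [p i] is the Lebesgue pairing of [U e^(V/2)] with [r i], which is
   square integrable because [p i] is bounded and [e^-W] is Gaussian. *)
pose r (i : 'I_m) x := p i x * expR (- W x / 2).
have cp i : continuous (p i) by case: (bp i).
have cr i : continuous (r i) by rewrite /r; cont; exact: cp.
have r2E i x : r i x ^+ 2 = p i x ^+ 2 * expR (- W x).
  by rewrite /r exprMn expr2 [expR _ ^+ 2]expr2 -expRD; congr (_ * expR _); field.
have ir i : intgR (fun x => r i x ^+ 2).
  have [_ [M hM]] := bp i.
  apply: (intgR_le _ _ (intgRZ (M ^+ 2) (intgR_gauss rho_gt0))).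
    by apply: continuous_measurable_fun; cont; exact: cr.
  move=> x; rewrite ger0_norm ?sqr_ge0// r2E ler_wpM2r ?expR_ge0//.
  by rewrite -real_normK ?num_real// lerXn2r ?nnegrE// (le_trans _ (hM x)).
have /choice[h hh] : forall i, exists h, [/\ cont_compact h,
    intgR (fun x => (r i x - h x) ^+ 2) & I (fun x => (r i x - h x) ^+ 2) <= delta].
  by move=> i; exact: L2_truncation.
(* Pairing [U e^(V/2)] with [h i] is pairing [U] with [g i]; by parts, this is minus the moment of
   [phi] against the primitive of [g i]. *)
pose g i x := expR (V x / 2) * h i x.
have cg i : cont_compact (g i).
  by apply: ccMr; [cont|case: (hh i)].
pose C := kappa + c - eps.
(* The constant is the one that [dual_ineq] yields when its [S] is [2 * K] times the sum of the
   squared moments. *)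
exists (Num.max 0 C * (2 * K)), (fun i => prim (g i)); split.
- by rewrite mulr_ge0 ?mulr_ge0// le_max lexx.
- move=> i; split; first exact: is_derive_cont (prim_derive (cg i)).
  by exists (I (fun y => `|g i y|)) => x; exact: prim_le.
move=> phi phi' Cphi orth; have ccphi := C1cc Cphi.
have ccphi' := C1_compact_deriv0 Cphi.
pose U := prim (fun x => phi x * expR (- V x)).
pose U' x := phi x * expR (- V x).
have CU : C1_compact U U' by apply: C1_compact_prim => //; exact: cc_weight.
have ccU := C1cc CU; have cU := cc_cont ccU.
set A := wint V (fun x => phi' x ^+ 2); set B := wint V (fun x => phi x ^+ 2).
pose D := I (fun x => U x ^+ 2 * expR (V x)).
have BE : B = I (fun x => U' x ^+ 2 * expR (V x)).
  apply: Int_ext => x; rewrite /U' exprMn -[RHS]mulrA; congr (_ * _).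
  by rewrite expr2 -!expRD; congr expR; ring.
have A0 : 0 <= A by apply: wint_ge0 => x; exact: sqr_ge0.
have B0 : 0 <= B by apply: wint_ge0 => x; exact: sqr_ge0.
have D0 : 0 <= D by apply: Int_ge0 => x; rewrite mulr_ge0 ?sqr_ge0 ?expR_ge0.
have [dphi cphi' _] := Cphi; have [dU cU' _] := CU.
have sqrtW (y s : R) : (y * expR (s / 2)) ^+ 2 = y ^+ 2 * expR s.
  by rewrite exprMn [expR _ ^+ 2]expr2 -expRD; congr (_ * expR _); field.
have BAD : B ^+ 2 <= A * D.
  (* [B] is the integral of [U' * phi]; after integration by parts, the factor 1 is split as
     [e^(-V/2) e^(V/2)] for Cauchy-Schwarz. *)
  have -> : B = - I (fun x => (phi' x * expR (- V x / 2)) * (U x * expR (V x / 2))).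
    rewrite (_ : B = I (fun x => U' x * phi x)); last first.
      by apply: Int_ext => x; rewrite /U'; ring.
    rewrite (Int_by_parts CU dphi cphi'); congr (- _); apply: Int_ext => x.
    by rewrite mulrACA -expRD (_ : _ + _ = 0) ?expR0 ?mulr1 1?mulrC//; ring.
  rewrite sqrrN.
  have -> : A = I (fun x => (phi' x * expR (- V x / 2)) ^+ 2).
    by apply: Int_ext => x; rewrite sqrtW.
  have -> : D = I (fun x => (U x * expR (V x / 2)) ^+ 2).
    by apply: Int_ext => x; rewrite sqrtW.
  have cc1 : cont_compact (fun x => phi' x * expR (- V x / 2)) by apply: ccMl => //; cont.
  have cc2 : cont_compact (fun x => U x * expR (V x / 2)) by apply: ccMl => //; cont.
  apply: Int_Cauchy_Schwarz; apply: cont_compact_intgR; try exact: ccX.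
  by apply: ccMl => //; exact: cc_cont.
pose u x := U x * expR (V x / 2).
have ccu : cont_compact u by apply: ccMl => //; cont.
have uE : D = I (fun x => u x ^+ 2).
  by apply: Int_ext => x; rewrite /u sqrtW.
pose mom i := wint V (fun x => phi x * prim (g i) x).
have moment i : wint W (fun x => psi U x * p i x) ^+ 2 <= 2 * mom i ^+ 2 + 2 * delta * D.
  have [cch irh rhd] := hh i.
  have ccrh : cont_compact (fun x => u x * (r i x - h i x)).
    by apply: ccMl => //; cont; [exact: cr|exact: cc_cont].
  have -> : wint W (fun x => psi U x * p i x) =
      I (fun x => u x * h i x) + I (fun x => u x * (r i x - h i x)).
    rewrite -IntD; last 2 first.
    - by apply: cont_compact_intgR; apply: ccMl => //; exact: cc_cont.
    - exact: cont_compact_intgR.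
    apply: Int_ext => x; rewrite /psi /u /r.
    rewrite (_ : expR ((V x + W x) / 2) = expR (V x / 2) * expR (W x / 2)); last first.
      by rewrite -expRD; congr expR; field.
    rewrite (_ : expR (- W x / 2) = expR (W x / 2) * expR (- W x)); last first.
      by rewrite -expRD; congr expR; field.
    by ring.
  have -> : I (fun x => u x * h i x) = - mom i.
    rewrite (_ : mom i = I (fun x => U' x * prim (g i) x)); last first.
      by apply: Int_ext => x; rewrite /U'; ring.
    rewrite (Int_by_parts CU (prim_derive (cg i)) (cc_cont (cg i))) opprK.
    by apply: Int_ext => x; rewrite /u /g; ring.
  set b := I _.
  have bD : b ^+ 2 <= delta * D.
    apply: (@le_trans _ _ (D * I (fun x => (r i x - h i x) ^+ 2))).
      rewrite uE; apply: Int_Cauchy_Schwarz => //.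
      - by apply: cont_compact_intgR; exact: ccX.
      - exact: cont_compact_intgR.
    by rewrite mulrC ler_wpM2r.
  (* The moment is [b - mom i], and [2 mom^2 + 2 b^2 - (b - mom)^2 = (mom + b)^2]. *)
  have := sqr_ge0 (mom i + b); rewrite -subr_ge0.
  by nra.
pose S := 2 * K * \sum_(i < m) mom i ^+ 2.
(* Adding [twisted_ineq] to the inequality for [psi U] bounds [(kappa + c - eps / 2) * D] by [B]
   plus the penalty. The truncation error in the penalty costs at most [eps / 2 * D], and the rest
   is [S]. *)
have CDS : C * D <= B + S.
  have := gapK _ _ (C1_psi CU).
  rewrite (_ : wint W (fun x => psi U x ^+ 2) = D); last first.
    by apply: Int_ext => x; rewrite /psi exprMn -[LHS]mulrA expR_half.
  have := twisted_ineq CU; rewrite -BE -/D.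
  have : \sum_(i < m) wint W (fun x => psi U x * p i x) ^+ 2 <=
      2 * \sum_(i < m) mom i ^+ 2 + m%:R * (2 * delta * D).
    rewrite mulr_sumr.
    apply: (@le_trans _ _ (\sum_(i < m) (2 * mom i ^+ 2 + 2 * delta * D))).
      by apply: ler_sum => i _; exact: moment.
    by rewrite big_split/= sumr_const card_ord [m%:R * _]mulr_natl.
  move=> /(ler_wpM2l K0).
  have : K * (m%:R * (2 * delta * D)) <= eps / 2 * D.
    rewrite (_ : _ * _ = (K * m%:R * (2 * delta)) * D); last by ring.
    rewrite ler_wpM2r// /delta.
    rewrite (_ : _ * _ = (K * m%:R / (K * m%:R + 1)) * (eps / 2)); last first.
      by field; rewrite gt_eqF.
    by rewrite ler_piMl ?ltW// ltr_pdivrMr// mul1r ltrDl.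
  by rewrite /C /S; lra.
have S0 : 0 <= S.
  by rewrite !mulr_ge0// sumr_ge0// => i _; exact: sqr_ge0.
have := dual_ineq A0 B0 D0 S0 BAD CDS.
by rewrite /S !mulrA.
Qed.

End Orthogonal.
End Gap.

(** * Removal of the mean-zero condition, and induction for the harmonic potential *)

Section GapIteration.
Context {R : realType}.
Local Notation mu := (@lebesgue_measure R).
Local Notation I f := (Rintegral mu setT f).
Implicit Types (V f g phi : R -> R) (x : R).

Let sqrB_le (eta a b : R) : 0 < eta ->
  (a + b) ^+ 2 <= (1 + eta) * a ^+ 2 + (1 + eta^-1) * b ^+ 2.
Proof.
move=> e0; rewrite -subr_ge0 (_ : _ - _ = (eta * a - b) ^+ 2 / eta); last first.
  by field; rewrite gt_eqF.
by rewrite divr_ge0 ?sqr_ge0 ?ltW.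
Qed.

Lemma bounded_cont_cst (c : R) : bounded_cont (fun _ : R => c).
Proof. by split; [exact: cont_const|exists `|c|]. Qed.

(* Subtracting a multiple of [b] makes a test function orthogonal to the constants;
   if there is no such [b], then every test function already is. *)
Lemma gap_of_orthogonal V (C : R) (m : nat) : continuous V ->
  (forall eps : R, 0 < eps ->
    exists (K : R) (p : 'I_m -> R -> R), [/\ 0 <= K, forall i, bounded_cont (p i) &
      forall phi phi', C1_compact phi phi' -> wint V phi = 0 ->
        (C - eps) * wint V (fun x => phi x ^+ 2)
        - K * \sum_(i < m) wint V (fun x => phi x * p i x) ^+ 2
        <= wint V (fun x => phi' x ^+ 2)]) ->
  gap V C m.+1.
Proof.
move=> cV H eps e0; have e20 : 0 < eps / 2 by rewrite divr_gt0.
have [K [p [K0 bp Kp]]] := H _ e20.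
(* The new weight, at index [ord0], is the constant 1: its moment is the mean of [phi]. *)
pose p' (i : 'I_m.+1) : R -> R := if unlift ord0 i is Some j then p j else fun _ => 1.
have bp' i : bounded_cont (p' i).
  by rewrite /p'; case: unliftP => [j _|_] //; exact: bounded_cont_cst.
have sump' phi : \sum_(i < m.+1) wint V (fun x => phi x * p' i x) ^+ 2 =
    wint V phi ^+ 2 + \sum_(i < m) wint V (fun x => phi x * p i x) ^+ 2.
  rewrite big_ord_recl /p' unlift_none; congr (_ ^+ 2 + _).
    by apply: wint_ext => x; rewrite mulr1.
  by apply: eq_bigr => i _; rewrite liftK.
have sum0 phi : 0 <= \sum_(i < m) wint V (fun x => phi x * p i x) ^+ 2.
  by rewrite sumr_ge0// => i _; exact: sqr_ge0.
have [CC|CC] := leP (C - eps / 2) 0.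
  exists 0, p'; split => // phi phi' _; rewrite mul0r subr0.
  apply: (@le_trans _ _ 0); last by apply: wint_ge0 => x; exact: sqr_ge0.
  apply: mulr_le0_ge0; first by lra.
  by apply: wint_ge0 => x; exact: sqr_ge0.
have [[b [b' [Cb nb]]]|nob] := pselect (exists b b', C1_compact b b' /\ wint V b != 0);
    last first.
  exists K, p'; split => // phi phi' Cphi.
  have phi0 : wint V phi = 0.
    by apply/eqP/negP => /negP h; apply: nob; exists phi, phi'.
  apply: le_trans (Kp _ _ Cphi phi0); rewrite sump' phi0 expr0n add0r lerD2r.
  apply: ler_wpM2r; last by lra.
  by apply: wint_ge0 => x; exact: sqr_ge0.
(* With this [eta], [C - eps = C2 (1 - 2 eta)], and [(1 - 2 eta) (1 + eta)^2 <= 1]; hence two losses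
   of a factor [1 + eta] fit into [eps / 2]. *)
pose C2 := C - eps / 2; pose eta := eps / (4 * C2).
have eta0 : 0 < eta by rewrite divr_gt0// mulr_gt0.
pose Ab := wint V (fun x => b' x ^+ 2); pose Bb := wint V (fun x => b x ^+ 2).
pose pb i := wint V (fun x => b x * p i x).
have Ab0 : 0 <= Ab by apply: wint_ge0 => x; exact: sqr_ge0.
have Bb0 : 0 <= Bb by apply: wint_ge0 => x; exact: sqr_ge0.
have pb0 : 0 <= \sum_(i < m) pb i ^+ 2 by exact: sum0.
(* [L] collects the coefficients of [c ^+ 2] caused by the correction [c * b] in the energy, the
   norm and the moments. Since [c] is the quotient of the means of [phi] and [b], [L * c ^+ 2]
   becomes a penalty on the mean of [phi]. *)
pose L := (1 + eta^-1) * Ab + C2 * (1 + eta^-1) * Bb + 2 * K * \sum_(i < m) pb i ^+ 2.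
have ei0 : 0 < 1 + eta^-1 by rewrite addr_gt0// invr_gt0.
have L0 : 0 <= L.
  by rewrite /L !addr_ge0 ?mulr_ge0//; exact: ltW.
exists (2 * K + L / wint V b ^+ 2), p'; split => //.
  by apply: addr_ge0; [exact: mulr_ge0|rewrite divr_ge0// sqr_ge0].
move=> phi phi' Cphi; rewrite sump'.
pose c := wint V phi / wint V b.
have ccphi := C1cc Cphi; have ccb := C1cc Cb.
have ccphi' := C1_compact_deriv0 Cphi; have ccb' := C1_compact_deriv0 Cb.
have Cphi0 := C1D Cphi (C1Z (- c) Cb).
have ccphi0 := C1cc Cphi0; have ccphi0' := C1_compact_deriv0 Cphi0.
set phi0 := (fun x => phi x + - c * b x) in Cphi0 ccphi0.
set phi0' := (fun x => phi' x + - c * b' x) in Cphi0 ccphi0'.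
have cccb : cont_compact (fun x => - c * b x) by apply: ccMr => //; exact: cont_const.
have orth : wint V phi0 = 0.
  by rewrite wintD// wintZ// /c mulNr divfK// subrr.
have := Kp _ _ Cphi0 orth.
set A0 := wint V (fun x => phi0' x ^+ 2); set B0 := wint V (fun x => phi0 x ^+ 2).
set q0 := \sum_(i < m) _.
set A := wint V (fun x => phi' x ^+ 2); set B := wint V (fun x => phi x ^+ 2).
set q := \sum_(i < m) wint V (fun x => phi x * p i x) ^+ 2.
have Ale : A0 <= (1 + eta) * A + (1 + eta^-1) * c ^+ 2 * Ab.
  apply: wint_sqr_le => // x.
  by have := sqrB_le (phi' x) (- c * b' x) eta0; rewrite /phi0' exprMn sqrrN; lra.
have Ble : B <= (1 + eta) * B0 + (1 + eta^-1) * c ^+ 2 * Bb.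
  apply: wint_sqr_le => // x.
  have := sqrB_le (phi0 x) (c * b x) eta0; rewrite exprMn.
  by rewrite {1}/phi0 mulNr subrK; lra.
have qle : q0 <= 2 * q + 2 * c ^+ 2 * \sum_(i < m) pb i ^+ 2.
  rewrite /q0 /q !mulr_sumr -big_split/=; apply: ler_sum => i _.
  have cpi : continuous (p i) by case: (bp i).
  have -> : wint V (fun x => phi0 x * p i x) =
      wint V (fun x => phi x * p i x) + - c * pb i.
    rewrite -wintZ//; last exact: ccMl.
    rewrite -wintD//; [|exact: ccMl|by apply: ccMr; [exact: cont_const|exact: ccMl]].
    by apply: wint_ext => x; rewrite /phi0; ring.
  have := sqr_ge0 (wint V (fun x => phi x * p i x) + c * pb i).
  by nra.
have B00 : 0 <= B0 by apply: wint_ge0 => x; exact: sqr_ge0.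
have BB0 : 0 <= B by apply: wint_ge0 => x; exact: sqr_ge0.
have qq0 : 0 <= q by exact: sum0.
rewrite -/C2 => KK.
have cE : L / wint V b ^+ 2 * wint V phi ^+ 2 = L * c ^+ 2.
  by rewrite /c exprMn exprVn; ring.
have Kq : 0 <= K * q by exact: mulr_ge0.
have Lw : 0 <= L / wint V b ^+ 2 * q.
  by apply: mulr_ge0 => //; apply: divr_ge0 => //; exact: sqr_ge0.
have Kw : 0 <= 2 * K * wint V phi ^+ 2 by apply: mulr_ge0; [exact: mulr_ge0|exact: sqr_ge0].
have main : C2 * B <= (1 + eta) ^+ 2 * A + (1 + eta) * (2 * K * q + L * c ^+ 2).
  have h1 := ler_wpM2l (ltW CC) Ble.
  have h2 := ler_wpM2l K0 qle.
  have eta1 : 0 <= 1 + eta by lra.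
  have h3 : C2 * B0 <= (1 + eta) * A + (1 + eta^-1) * c ^+ 2 * Ab +
      K * (2 * q + 2 * c ^+ 2 * \sum_(i < m) pb i ^+ 2) by lra.
  have h4 := ler_wpM2l eta1 h3.
  (* The [Bb] term comes from [h1] without the factor [1 + eta] that multiplies [L] in the claim;
     this is the excess. *)
  have h5 : 0 <= eta * (C2 * (1 + eta^-1) * Bb * c ^+ 2).
    apply: mulr_ge0; first exact: ltW.
    apply: mulr_ge0; last exact: sqr_ge0.
    by apply: mulr_ge0 => //; apply: mulr_ge0; exact: ltW.
  apply: (le_trans h1); rewrite -subr_ge0.
  have := h4; rewrite -subr_ge0.
  rewrite /L -/C2.
  by move: h5; set s := \sum_(i < m) pb i ^+ 2; set d := eta^-1; lra.
have eta1 : 0 < 1 + eta by lra.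
have E1 : 1 <= (1 + eta) ^+ 2 by have := sqr_ge0 eta; nra.
have C2eta : (C - eps) * (1 + eta) ^+ 2 <= C2.
  have -> : C = C2 + eps / 2 by rewrite /C2; ring.
  have -> : eps = 4 * C2 * eta by rewrite /eta; field; rewrite gt_eqF.
  rewrite -subr_ge0 (_ : _ - _ = C2 * eta ^+ 2 * (3 + 2 * eta)); last by field.
  by apply: mulr_ge0; [apply: mulr_ge0; [exact: ltW|exact: sqr_ge0]|lra].
rewrite -(ler_pM2l (lt_le_trans ltr01 E1)).
set X := 2 * K * q + L * c ^+ 2 in main.
have X0 : 0 <= X by apply: addr_ge0; [rewrite -mulrA mulr_ge0|apply: mulr_ge0 => //; exact: sqr_ge0].
have h6 : (C - eps) * (1 + eta) ^+ 2 * B <= C2 * B by exact: ler_wpM2r.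
have h7 : (1 + eta) * X <= (1 + eta) ^+ 2 * X.
  by rewrite ler_wpM2r// expr2 ler_peMr ?ltW//; lra.
have h8 : (1 + eta) ^+ 2 * X <= (1 + eta) ^+ 2 *
    ((2 * K + L / wint V b ^+ 2) * (wint V phi ^+ 2 + q)).
  rewrite ler_pM2l ?(lt_le_trans ltr01 E1)// /X -cE.
  by rewrite mulrDl !mulrDr; lra.
by rewrite mulrBr mulrCA mulrA; lra.
Qed.

Lemma gap_step V (V1 V2 : R -> R) (rho kappa c : R) (m : nat) :
  (forall x, is_derive x 1 V (V1 x)) -> (forall x, is_derive x 1 V1 (V2 x)) ->
  continuous V2 -> 0 < rho ->
  (forall x, kappa <= V2 x / 2 + V1 x ^+ 2 / 4 + rho / 2 - rho ^+ 2 * x ^+ 2 / 4) ->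
  gap (fun x => rho / 2 * x ^+ 2) c m -> gap V (kappa + c) m.+1.
Proof.
move=> dV dV1 cV2 r0 conv gW; apply: gap_of_orthogonal; first exact: is_derive_cont dV.
exact: gap_orthogonal dV dV1 cV2 r0 conv _ _ gW.
Qed.

(** For this potential the curvature condition of [gap_step] is an equality with [kappa = rho], so
    each further moment raises the constant by [rho]. *)
Lemma gap_harmonic (rho : R) (m : nat) : 0 < rho ->
  gap (fun x => rho / 2 * x ^+ 2) (rho * m%:R) m.
Proof.
move=> r0; elim: m => [|m ih]; first by rewrite mulr0; exact: gap0.
rewrite -[m.+1%:R]natr1 mulrDr mulr1 addrC.
apply: (@gap_step _ (fun x => rho * x) (fun=> rho) rho) => //.
- move=> x; have -> : (fun x => rho / 2 * x ^+ 2) = (fun x => rho / 2 * (x * x)).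
    by apply/funext => y; rewrite expr2.
  apply: (is_derive_eq (derZ (rho / 2) (derM (der_id x) (der_id x)))).
  by field.
- by move=> x; have := derZ rho (der_id x); rewrite mulr1.
- exact: cont_const.
- by move=> x; rewrite exprMn; lra.
Qed.

End GapIteration.

(** * Continuity of the inner product under [L^2] convergence *)

Section SquareIntegrable.
Context {R : realType}.
Local Notation mu := (@lebesgue_measure R).
Local Notation I f := (Rintegral mu setT f).
Implicit Types (f g : R -> R) (x : R).

Definition sqint f := measurable_fun setT f /\ intgR (fun x => f x ^+ 2).

Lemma sqintM f g : sqint f -> sqint g -> intgR (fun x => f x * g x).
Proof.
move=> [mf hf] [mg hg]; apply: (intgR_le _ _ (intgRD hf hg)).
  exact: measurable_funM.
move=> x; have h1 := sqr_ge0 (f x - g x); have h2 := sqr_ge0 (f x + g x).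
by rewrite ler_norml; apply/andP; split; nra.
Qed.

Lemma sqintB f g : sqint f -> sqint g -> sqint (fun x => f x - g x).
Proof.
move=> hf hg; have [mf if2] := hf; have [mg ig2] := hg; split.
  exact: measurable_funB.
rewrite (_ : (fun x => _) = (fun x => f x ^+ 2 + ((-2) * (f x * g x) + g x ^+ 2))).
  by apply: intgRD => //; apply: intgRD => //; apply: intgRZ; exact: sqintM.
by apply/funext => x; ring.
Qed.

Lemma norm_Int_le f g : sqint f -> sqint g ->
  `|I (fun x => f x * g x)| <=
  Num.sqrt (I (fun x => f x ^+ 2)) * Num.sqrt (I (fun x => g x ^+ 2)).
Proof.
move=> hf hg; have [mf if2] := hf; have [mg ig2] := hg.
rewrite -sqrtrM; last by apply: Int_ge0 => x; exact: sqr_ge0.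
rewrite -sqrtr_sqr ler_sqrt.
  by apply: Int_Cauchy_Schwarz => //; exact: sqintM.
by apply: mulr_ge0; apply: Int_ge0 => x; exact: sqr_ge0.
Qed.

(** Write [F G - f g = (F - f) g + f (G - g) + (F - f) (G - g)] and apply Cauchy-Schwarz to each
    term; [e] is the resulting bound. *)
Lemma cvg_IntM (F G : nat -> R -> R) f g :
  (forall k, sqint (F k)) -> (forall k, sqint (G k)) -> sqint f -> sqint g ->
  (fun k => I (fun x => (F k x - f x) ^+ 2)) @ \oo --> (0 : R) ->
  (fun k => I (fun x => (G k x - g x) ^+ 2)) @ \oo --> (0 : R) ->
  (fun k => I (fun x => F k x * G k x)) @ \oo --> I (fun x => f x * g x).
Proof.
move=> hF hG hf hg.
have cs u : u @ \oo --> (0 : R) -> (fun k : nat => Num.sqrt (u k)) @ \oo --> (0 : R).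
  move=> /(continuous_cvg _ (@sqrt_continuous R 0)).
  by rewrite sqrtr0.
move=> /cs; set a := (fun k => Num.sqrt _) => a0.
move=> /cs; set b := (fun k => Num.sqrt _) => b0.
pose A := Num.sqrt (I (fun x => f x ^+ 2)); pose B := Num.sqrt (I (fun x => g x ^+ 2)).
pose e k := a k * B + A * b k + a k * b k.
have e0 : e @ \oo --> (0 : R).
  rewrite (_ : 0 = 0 * B + A * 0 + 0 * 0); last by ring.
  by apply: cvgD; [apply: cvgD; apply: cvgM => //; exact: cvg_cst|exact: cvgM].
have le_e k : `|I (fun x => F k x * G k x) - I (fun x => f x * g x)| <= e k.
  have hFf := sqintB (hF k) hf; have hGg := sqintB (hG k) hg.
  have -> : I (fun x => F k x * G k x) = I (fun x => f x * g x) +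
     (I (fun x => (F k x - f x) * g x) + I (fun x => f x * (G k x - g x)) +
      I (fun x => (F k x - f x) * (G k x - g x))).
    rewrite -IntD; [|exact: sqintM|exact: sqintM].
    rewrite -IntD; [|apply: intgRD; exact: sqintM|exact: sqintM].
    rewrite -IntD; [|exact: sqintM|].
      by apply: Int_ext => x; ring.
    by apply: intgRD; [apply: intgRD; exact: sqintM|exact: sqintM].
  rewrite addrAC subrr add0r.
  by rewrite (le_trans (ler_normD _ _))// lerD ?(le_trans (ler_normD _ _))// ?lerD//;
    exact: norm_Int_le.
set l := I (fun x => f x * g x).
apply: (@squeeze_cvgr _ _ _ _ (fun k => l - e k) (fun k => l + e k)).
- by near=> k; have := le_e k; rewrite ler_distl.
- rewrite -[X in _ --> X]subr0; apply: cvgB => //; exact: cvg_cst.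
- rewrite -[X in _ --> X]addr0; apply: cvgD => //; exact: cvg_cst.
Unshelve. all: by end_near. Qed.

End SquareIntegrable.

(** * From Poincare inequalities with moments to the min-max values *)

Section MinMax.
Context {R : realType}.
Local Notation mu := (@lebesgue_measure R).
Local Notation I f := (Rintegral mu setT f).
Implicit Types (f g phi : R -> R) (x : R).

Lemma smooth_derive f n x : smooth f ->
  is_derive x 1 (derive1n n f) (derive1n n.+1 f x).
Proof.
by move=> sf; apply: DeriveDef; [exact: sf|rewrite derive1nS derive1E].
Qed.

Lemma smooth_cont f n : smooth f -> continuous (derive1n n f).
Proof. by move=> sf; apply: is_derive_cont => x; exact: smooth_derive. Qed.

Lemma smooth_compact_C1 f : smooth_compact f -> C1_compact f (derive1 f).
Proof.
move=> [sf hf]; split => //; first by move=> x; exact: (@smooth_derive f 0).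
exact: (@smooth_cont f 1).
Qed.

Lemma cvg_sum_sqr n (u : 'I_n -> nat -> R) : (forall i, u i @ \oo --> (0 : R)) ->
  (fun k => \sum_(i < n) u i k ^+ 2) @ \oo --> (0 : R).
Proof.
elim: n u => [|n ih] u u0.
  by under eq_cvg do rewrite big_ord0; exact: cvg_cst.
under eq_cvg do rewrite big_ord_recl expr2.
have := cvgM (u0 ord0) (u0 ord0); rewrite mulr0 => /(_ _) h.
have := cvgD h (ih _ (fun i => u0 (lift ord0 i))); rewrite addr0.
by apply.
Qed.

Variable V : R -> R.
Hypothesis sV : smooth V.
Hypothesis intV : intgR (fun x => expR (- V x)).
Hypothesis Z_gt0 : 0 < Zc V.

(** The normalised potential: [expR (- Vn x)] is the probability density [dens V x], while the
    derivatives stay those of [V]. *)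
Let Vn x := V x + ln (Zc V).

Let dVn x : is_derive x 1 Vn (derive1 V x).
Proof.
have := derD (@smooth_derive V 0 x sV) (der_cst (ln (Zc V)) x).
by rewrite addr0.
Qed.

Let cVn : continuous Vn := is_derive_cont dVn.

Let densE x : dens V x = expR (- Vn x).
Proof. by rewrite /dens /Vn opprD expRD [expR (- ln _)]expRN lnK. Qed.

(** Multiplication by the square root of the density turns [ip V] into the Lebesgue inner
    product. *)
Let wt f x := f x * expR (- Vn x / 2).

Let wtM f g x : wt f x * wt g x = f x * g x * expR (- Vn x).
Proof. by rewrite /wt mulrACA -expRD; congr (_ * expR _); field. Qed.

Let wt_sqr f x : wt f x ^+ 2 = f x ^+ 2 * dens V x.
Proof. by rewrite expr2 wtM densE -expr2. Qed.

Let ipE f g : ip V f g = I (fun x => wt f x * wt g x).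
Proof. by apply: Int_ext => x; rewrite wtM densE. Qed.

Let ip_wint f g : ip V f g = wint Vn (fun x => f x * g x).
Proof. by apply: Int_ext => x; rewrite densE. Qed.

Let sqint_wt f : L2 V f -> sqint (wt f).
Proof.
move=> [mf hf].
have mw : measurable_fun setT (wt f).
  apply: measurable_funM => //; apply: continuous_measurable_fun.
  by rewrite /wt; cont.
have mw2 : measurable_fun setT (fun x => wt f x ^+ 2) by apply: measurable_funX.
split => //; apply/integrableP; split; first exact/measurable_EFinP.
rewrite (_ : (fun x => _) = (fun x => (f x ^+ 2 * dens V x)%:E))//.
by apply/funext => x; rewrite /= ger0_norm ?sqr_ge0// wt_sqr.
Qed.

Let L2_intgR f : measurable_fun setT f -> intgR (fun x => f x ^+ 2 * dens V x) ->
  L2 V f.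
Proof.
move=> mf /integrableP[_ h]; split => //.
rewrite (_ : (fun x => _) = (fun x => `|(f x ^+ 2 * dens V x)%:E|%E))//.
apply/funext => x; rewrite densE abse_EFin ger0_norm//.
by apply: mulr_ge0; [exact: sqr_ge0|exact: expR_ge0].
Qed.

Let L2_cc f : cont_compact f -> L2 V f.
Proof.
move=> cf; apply: L2_intgR; first exact: continuous_measurable_fun (cc_cont cf).
rewrite (_ : (fun x => _) = (fun x => f x ^+ 2 * expR (- Vn x))).
  by apply: wint_int => //; exact: ccX.
by apply/funext => x; rewrite densE.
Qed.

Let L2_bounded f : bounded_cont f -> L2 V f.
Proof.
move=> [cf [M hM]]; have mf := continuous_measurable_fun cf.
apply: L2_intgR => //; apply: (intgR_le _ _ (intgRZ (M ^+ 2 / Zc V) intV)).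
  apply: continuous_measurable_fun.
  rewrite (_ : (fun x => _) = (fun x => f x ^+ 2 * expR (- Vn x))); first by cont.
  by apply/funext => x; rewrite densE.
move=> x; have d0 : 0 <= dens V x by rewrite densE expR_ge0.
rewrite ger0_norm; last by rewrite mulr_ge0// sqr_ge0.
rewrite (_ : M ^+ 2 / _ * _ = M ^+ 2 * dens V x); last by rewrite /dens; ring.
rewrite ler_wpM2r// -real_normK ?num_real// lerXn2r ?nnegrE//.
by rewrite (le_trans _ (hM x)).
Qed.

(** Integration by parts, as the derivative of [phi' e^-Vn] is [Lop V phi] times [e^-Vn]. *)
Let ip_Lop phi : smooth_compact phi ->
  ip V phi (Lop V phi) = - wint Vn (fun x => derive1 phi x ^+ 2).
Proof.
move=> sphi; have Cphi := smooth_compact_C1 sphi; have [sf _] := sphi.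
have cV1 := @smooth_cont V 1 sV; have c1 := @smooth_cont phi 1 sf.
have c2 := @smooth_cont phi 2 sf.
have dE x : is_derive x 1 (fun x => -1 * Vn x) (-1 * derive1 V x) by exact: derZ.
have dg x := derM (@smooth_derive phi 1 x sf) (der_expR (dE x)).
have cg : continuous (fun x => derive1n 2 phi x * expR (-1 * Vn x) +
    derive1n 1 phi x * (expR (-1 * Vn x) * (-1 * derive1 V x))) by cont.
have <- : I (fun x => derive1 phi x * (derive1 phi x * expR (-1 * Vn x))) =
    wint Vn (fun x => derive1 phi x ^+ 2).
  by apply: Int_ext => x; rewrite mulN1r mulrA expr2.
rewrite (Int_by_parts Cphi dg cg) opprK.
by apply: Int_ext => x; rewrite densE /Lop mulN1r derive1n1; ring.
Qed.

(** The weights [p] are used as the functions [gs]. The inequality holds for the approximants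
    [phi k] of a pair in the graph closure and passes to the limit, where the penalty disappears
    because [f] is orthogonal to every [p i]. *)
Lemma lambda_ge_of_gap (C : R) (n : nat) : gap Vn C n -> (C%:E <= lambda V n)%E.
Proof.
move=> gapV; apply/lee_subgt0Pr => eps e0.
have [K [p [K0 bp Kp]]] := gapV _ e0.
apply: le_ereal_sup_tmp; eexists.
  by exists p; split => // i; exact: L2_bounded.
apply/ereal_infP => _ [f [g [[L2f [L2g [phi [sphi [phif Lphig]]]]] nf fp ->]]].
rewrite -EFinB lee_fin.
have ff0 : 0 < ip V f f.
  rewrite lt_neqAle eq_sym nf ipE; apply: Int_ge0 => x.
  by rewrite -expr2 sqr_ge0.
rewrite ler_pdivlMr//.
have Cphi k := smooth_compact_C1 (sphi k).
have ccphi k := C1cc (Cphi k).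
have ccL k : cont_compact (Lop V (phi k)).
  rewrite (_ : Lop V (phi k) = fun x => derive1n 2 (phi k) x + (-1 * derive1 V x) * derive1 (phi k) x).
    have [sphk _] := sphi k; have cc1 := C1_compact_deriv0 (Cphi k).
    have C2 : C1_compact (derive1 (phi k)) (derive1n 2 (phi k)).
      split; [|exact: smooth_cont|by case: cc1].
      by move=> x; exact: (@smooth_derive (phi k) 1).
    apply: ccD; first exact: C1_compact_deriv0 C2.
    have cV1 := @smooth_cont V 1 sV.
    by apply: ccMr => //; cont.
  by apply/funext => x; rewrite /Lop mulN1r mulNr.
(* This restates both convergences of the graph closure in Lebesgue [L^2], as [cvg_IntM]
   requires. *)
have wt2 (u v : R -> R) : ip V (fun x => u x - v x) (fun x => u x - v x) =
    I (fun x => (wt u x - wt v x) ^+ 2).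
  by rewrite ipE; apply: Int_ext => x; rewrite -expr2 /wt mulrBl.
have phic : (fun k => I (fun x => (wt (phi k) x - wt f x) ^+ 2)) @ \oo --> (0 : R).
  by under eq_cvg do rewrite -wt2.
have Lphic : (fun k => I (fun x => (wt (Lop V (phi k)) x - wt g x) ^+ 2)) @ \oo --> (0 : R).
  by under eq_cvg do rewrite -wt2.
have sphik k : sqint (wt (phi k)) by apply: sqint_wt; exact: L2_cc.
have sLk k : sqint (wt (Lop V (phi k))) by apply: sqint_wt; exact: L2_cc.
have sf := sqint_wt L2f; have sg := sqint_wt L2g.
have cphi2 : (fun k => ip V (phi k) (phi k)) @ \oo --> ip V f f.
  by under eq_cvg do rewrite ipE; rewrite ipE; exact: cvg_IntM.
have cphiL : (fun k => ip V (phi k) (Lop V (phi k))) @ \oo --> ip V f g.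
  by under eq_cvg do rewrite ipE; rewrite ipE; exact: cvg_IntM.
have cphip i : (fun k => ip V (phi k) (p i)) @ \oo --> (0 : R).
  rewrite -(fp i); under eq_cvg do rewrite ipE; rewrite ipE.
  have sp := sqint_wt (L2_bounded (bp i)).
  apply: (@cvg_IntM _ _ (fun=> wt (p i))) => //.
  rewrite (_ : (fun k => _) = fun=> 0); first exact: cvg_cst.
  apply/funext => k; rewrite (_ : (fun x => _) = fun=> 0) ?Rintegral_cst ?mul0r//.
  by apply/funext => x; rewrite subrr expr0n.
have -> : ip V f (fun x => - g x) = - ip V f g.
  rewrite !ipE -mulN1r -IntZ; last exact: sqintM.
  by apply: Int_ext => x; rewrite /wt; ring.
have cs : (fun k => \sum_(i < n) ip V (phi k) (p i) ^+ 2) @ \oo --> (0 : R) by exact: cvg_sum_sqr.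
have H k : 0 <= - ip V (phi k) (Lop V (phi k)) - (C - eps) * ip V (phi k) (phi k)
    + K * \sum_(i < n) ip V (phi k) (p i) ^+ 2.
  have := Kp _ _ (Cphi k); rewrite ip_Lop// opprK !ip_wint.
  under [X in _ - K * X <= _]eq_bigr do rewrite -ip_wint.
  rewrite (_ : wint Vn (fun x => phi k x * phi k x) = wint Vn (fun x => phi k x ^+ 2)).
    by lra.
  by apply: wint_ext => x; rewrite expr2.
have : (fun k => - ip V (phi k) (Lop V (phi k)) - (C - eps) * ip V (phi k) (phi k)
    + K * \sum_(i < n) ip V (phi k) (p i) ^+ 2) @ \oo -->
    - ip V f g - (C - eps) * ip V f f + K * 0.
  apply: cvgD; last by apply: cvgM => //; exact: cvg_cst.
  apply: cvgB; first exact: cvgN.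
  by apply: cvgM => //; exact: cvg_cst.
set u := (fun k => _) => cu.
have : 0 <= - ip V f g - (C - eps) * ip V f f + K * 0.
  rewrite -(cvg_lim _ cu)//; apply: limr_ge; first by apply/cvg_ex; eexists; exact: cu.
  by near=> k; exact: H.
by rewrite mulr0 addr0 subr_ge0.
Unshelve. all: by end_near. Qed.

End MinMax.

Theorem mainTheorem9 (R : realType) (V : R -> R) (rho kappa : R) (n : nat) :
  smooth V ->
  (@lebesgue_measure R).-integrable setT (fun x => (expR (- V x))%:E) ->
  (0%:E < lambda V 1)%E ->
  0 < rho ->
  (forall x : R,
     kappa <= derive1n 2 V x / 2 + (derive1 V x) ^+ 2 / 4 + rho / 2
              - rho ^+ 2 * x ^+ 2 / 4) ->
  (1 <= n)%N ->
  ((rho * (n%:R - 1) + kappa)%:E <= lambda V n)%E.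
Proof.
case: n => // n sV intV _ rho_gt0 convV _.
(* From here on [n] is the predecessor, and the bound reads [kappa + rho * n]: the value [rho * n]
   comes from [n] moments for the harmonic potential, and one further step adds [kappa] and one
   moment. *)
rewrite -[n.+1%:R]natr1 addrK addrC.
have [Z0|Z0] := leP (Zc V) 0.
  (* Here [Zc V = 0], so [dens V] is [0] and there is no admissible test function. *)
  have {Z0}Z0 : Zc V = 0.
    by apply/eqP; rewrite eq_le Z0; apply: Int_ge0 => x; exact: expR_ge0.
  have L20 : L2 V (fun=> 0).
    split; first exact: measurable_cst.
    rewrite (_ : (fun x => _) = cst 0%E) ?integral0//.
    by apply/funext => x; rewrite expr0n mul0r.
  apply: le_ereal_sup_tmp; eexists; first by exists (fun _ _ => 0).
  apply/ereal_infP => q [f [g [_ /eqP nf _ _]]]; case: nf; rewrite /ip.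
  rewrite (_ : (fun x => _) = cst 0) ?Rintegral_cst ?mul0r//.
  by apply/funext => x; rewrite /dens Z0 invr0 !mulr0.
apply: lambda_ge_of_gap => //.
(* The step is applied to the normalised potential; adding a constant leaves both derivatives
   unchanged, so [convV] carries over. *)
apply: (@gap_step _ _ (derive1n 1 V) (derive1n 2 V) rho).
- by move=> x; have := derD (@smooth_derive _ V 0 x sV) (der_cst _ x); rewrite addr0.
- by move=> x; exact: smooth_derive.
- exact: smooth_cont.
- exact: rho_gt0.
- by move=> x; exact: convV.
- exact: gap_harmonic.
Qed.
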